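(* Let $\mu\in\mathbb{R}^2$, $\mu\neq0$, let $\Sigma\in\mathbb{R}^{2\times2}$ be symmetric positive definite, let $\mathbf{x}=(x_1,x_2)$ with $x_1,x_2\in\mathbb{R}^d$, and let $$t^*=t^*(\mu,\Sigma)=g^{-1}\big((\mu^T\Sigma^{-1}\mu)^{-1}\big),\qquad g(t)=\frac{\sigma_t^2}{\alpha_t^2}.$$ Then the GLASS denoiser $D_{\mu,\Sigma}$ and the standard denoiser $D_t$ (see context) satisfy $$D_{\mu,\Sigma}(\mathbf{x})=D_{t^*}\big(\alpha_{t^*}S(\mathbf{x})\big),\qquad\text{where } S(\mathbf{x})=\frac{\mu^T\Sigma^{-1}\mathbf{x}}{\mu^T\Sigma^{-1}\mu}\in\mathbb{R}^d,$$ and in the formula for $S$ the pair $\mathbf{x}$ is viewed as the $2\times d$ matrix with rows $x_1,x_2$.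
   Context: Data distribution: $p_{\rm data}$ is a probability distribution on $\mathbb{R}^d$; integrals written against $p_{\rm data}(z)\,\mathrm dz$ are integrals against this measure. Schedulers: $\alpha_t,\sigma_t\ge0$ ($0\le t\le1$) are continuously differentiable with $\alpha_0=\sigma_1=0$, $\alpha_1=\sigma_0=1$, $\alpha_t$ strictly increasing and $\sigma_t$ strictly decreasing. Hence $g(t)=\sigma_t^2/\alpha_t^2$ is an invertible (strictly decreasing) function from $(0,1]$ onto $[0,\infty)$. Standard denoiser: with $p_t(x|z)=\mathcal{N}(x;\alpha_tz,\sigma_t^2I_d)$, $p_t(x)=\mathbb{E}_{z\sim p_{\rm data}}[p_t(x|z)]$ and posterior $p_{1|t}(z|x)=p_t(x|z)p_{\rm data}(z)/p_t(x)$, set $D_t(x)=\int z\,p_{1|t}(z|x)\,\mathrm dz$ for $0<t<1$. GLASS denoiser: let $Z\sim p_{\rm data}$ and, conditionally on $Z=z=(z^1,\dots,z^d)$, let $\mathbf X=(X_1,X_2)$ with $X_1,X_2\in\mathbb{R}^d$ have density $\prod_{j=1}^d\mathcal{N}((x_1^j,x_2^j)^T;z^j\mu,\Sigma)$, i.e. the coordinate pairs are independent bivariate Gaussians with mean $z^j\mu$ and covariance $\Sigma$. Then $D_{\mu,\Sigma}(\mathbf{x})=\int z\,p(Z=z|\mathbf X=\mathbf{x})\,\mathrm dz$, the posterior being given by Bayes' rule with these Gaussian densities. *)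

(* Defs.v *)
From HB Require Import structures.
From mathcomp Require Import all_boot all_order all_algebra.
From mathcomp Require Import all_classical all_reals all_analysis.

Set Implicit Arguments.
Unset Strict Implicit.
Unset Printing Implicit Defensive.

Import Order.TTheory GRing.Theory Num.Theory.
Import numFieldNormedType.Exports.

Local Open Scope classical_set_scope.
Local Open Scope ring_scope.

(* R^d with its Borel sigma-algebra (the one generated by the open sets);
   the carrier is convertible to 'rV[R]_d. *)
Definition borel_rV (R : realType) (d : nat) :=
  g_sigma_algebraType (@open 'rV[R]_d).

(* At the endpoints 0 and 1 the difference quotients are one-sided. *)
Definition C1_unit_interval (R : realType) (f : R -> R) : Prop :=
  exists2 f' : R -> R,
    {within `[0, 1], continuous f'} &
    forall t, t \in `[0, 1] ->
      (f s - f t) / (s - t) @[s --> within `[0, 1] t^'] --> f' t.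

(* Only the values of alpha and sigma on [0, 1] are constrained. *)
Record scheduler (R : realType) (alpha sigma : R -> R) : Prop := Scheduler {
  scheduler_alpha_ge0 : {in `[0, 1], forall t, 0 <= alpha t} ;
  scheduler_sigma_ge0 : {in `[0, 1], forall t, 0 <= sigma t} ;
  scheduler_alpha_C1 : C1_unit_interval alpha ;
  scheduler_sigma_C1 : C1_unit_interval sigma ;
  scheduler_alpha0 : alpha 0 = 0 ;
  scheduler_sigma1 : sigma 1 = 0 ;
  scheduler_alpha1 : alpha 1 = 1 ;
  scheduler_sigma0 : sigma 0 = 1 ;
  scheduler_alpha_incr : {in `[0, 1] &, {homo alpha : s t / s < t}} ;
  scheduler_sigma_decr : {in `[0, 1] &, {homo sigma : s t /~ s < t}} }.

Definition posdefmx (R : realType) (n : nat) (A : 'M[R]_n) : Prop :=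
  A^T = A /\ forall u : 'cV[R]_n, u != 0 -> 0 < (u^T *m A *m u) 0 0.

(* Density of N(m, S) on R^n, meant for symmetric positive definite S. *)
Definition mvnormal_pdf (R : realType) (n : nat) (m : 'cV[R]_n) (S : 'M[R]_n)
    (x : 'cV[R]_n) : R :=
  (Num.sqrt ((2 * pi) ^+ n * \det S))^-1 *
  expR (- ((x - m)^T *m invmx S *m (x - m)) 0 0 / 2).

Section Denoisers.
Variables (R : realType) (d : nat) (p : probability (borel_rV R d) R).

(* For a likelihood lik z = p(x | z) of a fixed observation x, Bayes' rule
   gives the density of the posterior of z with respect to the prior p. *)
Definition posterior (lik : 'rV[R]_d -> R) (z : 'rV[R]_d) : R :=
  lik z / \int[p]_w lik w.

Definition posterior_mean (lik : 'rV[R]_d -> R) : 'rV[R]_d :=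
  \row_j \int[p]_z (z 0 j * posterior lik z).

Definition denoiser (alpha sigma : R -> R) (t : R) (x : 'rV[R]_d) : 'rV[R]_d :=
  posterior_mean
    (fun z => mvnormal_pdf (alpha t *: z)^T (sigma t ^+ 2)%:M x^T).

(* The rows of x are x_1 and x_2; its j-th column is the pair of the j-th
   coordinates of x_1 and x_2. *)
Definition glass_denoiser (mu : 'cV[R]_2) (Sigma : 'M[R]_2)
    (x : 'M[R]_(2, d)) : 'rV[R]_d :=
  posterior_mean
    (fun z => \prod_(j < d) mvnormal_pdf (z 0 j *: mu) Sigma (col j x)).

End Denoisers.

Definition inv_snr (R : realType) (alpha sigma : R -> R) (t : R) : R :=
  sigma t ^+ 2 / alpha t ^+ 2.

Definition mahalanobis (R : realType) (mu : 'cV[R]_2) (Sigma : 'M[R]_2) : R :=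
  (mu^T *m invmx Sigma *m mu) 0 0.

(* inv_snr is a bijection from ]0, 1] onto [0, +oo[ for every scheduler, so
   on [0, +oo[ its partial inverse is the inverse and the default value 0 is
   never used. *)
Definition tstar (R : realType) (alpha sigma : R -> R)
    (mu : 'cV[R]_2) (Sigma : 'M[R]_2) : R :=
  'pinv_(fun=> 0) `]0, 1] (inv_snr alpha sigma) (mahalanobis mu Sigma)^-1.

Definition suff_stat (R : realType) (d : nat) (mu : 'cV[R]_2)
    (Sigma : 'M[R]_2) (x : 'M[R]_(2, d)) : 'rV[R]_d :=
  (mahalanobis mu Sigma)^-1 *: (mu^T *m invmx Sigma *m x).

(* Main.v *)
(** Completing the square in [a], the exponent of N(y; a mu, Sigma) depends on
    [a] only through [m (a - s)^2], where [m = mu^T Sigma^-1 mu] and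
    [s = m^-1 mu^T Sigma^-1 y].  So, up to a nonzero constant factor, the GLASS
    likelihood of [z] is [exp (- m |z - S x|^2 / 2)]; the likelihood of [z] for
    the observation [alpha_t S x] is the same function with
    [alpha_t^2 / sigma_t^2] in place of [m], and t* is chosen so that these
    agree.  Constant factors cancel in Bayes' rule. *)

Require Import Defs.
From HB Require Import structures.
From mathcomp Require Import all_boot all_order all_algebra.
From mathcomp Require Import all_classical all_reals all_analysis.
From mathcomp Require Import measurable_realfun ring lra.

Set Implicit Arguments.
Unset Strict Implicit.
Unset Printing Implicit Defensive.

Import Order.TTheory GRing.Theory Num.Theory.
Import numFieldNormedType.Exports.

Local Open Scope classical_set_scope.
Local Open Scope ring_scope.

(** Integrability lets [c] come out of the normalising integral; it then cancels pointwise under the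
    outer integral. *)
Lemma posterior_meanZ (R : realType) (d : nat)
    (p : probability (borel_rV R d) R) (lik : 'rV[R]_d -> R) (c : R) :
  c != 0 -> p.-integrable setT (EFin \o lik) ->
  posterior_mean p (fun z => c * lik z) = posterior_mean p lik.
Proof.
move=> c0 intlik; apply/rowP => j; rewrite !mxE.
apply: eq_Rintegral => z _; congr (_ * _); rewrite /posterior RintegralZl//.
by rewrite invfM mulrACA divff// mul1r.
Qed.

Lemma measurable_coord (R : realType) (d : nat) (j : 'I_d) :
  measurable_fun setT (fun z : borel_rV R d => (z : 'rV[R]_d) 0 j).
Proof.
apply: (measurability _ (RGenOpens.measurableE R)).
move=> _ [_ [a [b ->]] <-]; rewrite setTI; apply: sub_sigma_algebra.
have /continuousP : continuous (fun z : 'rV[R]_d => z 0 j).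
  exact: coord_continuous.
by apply; exact: interval_open.
Qed.

(** Common shape of both likelihoods as functions of [z]: unnormalised, with precision [m] and
    centre [s]. *)
Definition gauss_kernel (R : realType) (d : nat) (m : R) (s z : 'rV[R]_d) : R :=
  expR (- (m / 2 * \sum_(j < d) (z 0 j - s 0 j) ^+ 2)).

(** For [0 <= m] the kernel is bounded by 1, and [p] has finite mass. *)
Lemma integrable_gauss_kernel (R : realType) (d : nat)
    (p : probability (borel_rV R d) R) (m : R) (s : 'rV[R]_d) :
  0 <= m -> p.-integrable setT (EFin \o gauss_kernel m s).
Proof.
move=> m0; apply: measurable_bounded_integrable => //.
- by rewrite (le_lt_trans (probability_le1 _ _))// ltry.
- apply: measurableT_comp => //; apply: measurableT_comp => //.
  apply: measurable_funM => //; apply: measurable_sum => j.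
  apply: measurable_funX; apply: measurable_funB => //.
  exact: measurable_coord.
- exists 1; split => // M M1 z _ /=.
  rewrite ger0_norm ?expR_ge0//; apply: le_trans (ltW M1).
  rewrite -expR0 ler_expR oppr_le0 mulr_ge0 ?divr_ge0// sumr_ge0// => j _.
  exact: sqr_ge0.
Qed.

Lemma det_mx22 (R : comNzRingType) (A : 'M[R]_2) :
  \det A = A 0 0 * A 1 1 - A 0 1 * A 1 0.
Proof.
rewrite (expand_det_row _ 0) !big_ord_recl big_ord0 /cofactor !det_mx11 !mxE.
rewrite /= expr0 expr1 mul1r mulN1r addr0 mulrN.
by congr (_ * A _ _ - A _ _ * A _ _); apply: val_inj.
Qed.

(** Serves twice: to invert [Sigma], and to see that the normalising factor of the bivariate density
    is nonzero. *)
Lemma posdefmx22_det_gt0 (R : realType) (A : 'M[R]_2) :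
  posdefmx A -> 0 < \det A.
Proof.
move=> [At Apos].
have A10 : A 1 0 = A 0 1 by rewrite -[in LHS]At mxE.
have quad (u : 'cV[R]_2) : (u^T *m A *m u) 0 0 =
    A 0 0 * u 0 0 ^+ 2 + 2 * A 0 1 * u 0 0 * u 1 0 + A 1 1 * u 1 0 ^+ 2.
  rewrite !mxE !big_ord_recl !big_ord0 !mxE !big_ord_recl !big_ord0 !mxE.
  rewrite (_ : lift ord0 ord0 = 1); last exact: val_inj.
  by rewrite A10; ring.
have A00 : 0 < A 0 0.
  have := Apos (\col_i (i == 0)%:R); rewrite quad !mxE /=.
  rewrite mulr0 expr0n mulr0 !addr0 expr1n mulr1; apply.
  by apply/eqP => /colP/(_ 0); rewrite !mxE => /eqP; rewrite oner_eq0.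
(* This vector gives the quadratic form the value [A 0 0 * \det A]. *)
have := Apos (\col_i if i == 0 then - A 0 1 else A 0 0); rewrite quad !mxE /=.
rewrite det_mx22 A10 => dpos.
rewrite -(pmulr_rgt0 _ A00); apply: lt_le_trans (dpos _) _; last by lra.
by apply/eqP => /colP/(_ 1); rewrite !mxE /=; apply/eqP; rewrite gt_eqF.
Qed.

(** The quadratic form of [Sigma] at [invmx Sigma *m mu] equals [mahalanobis mu Sigma]. *)
Lemma mahalanobis_gt0 (R : realType) (mu : 'cV[R]_2) (Sigma : 'M[R]_2) :
  mu != 0 -> posdefmx Sigma -> 0 < mahalanobis mu Sigma.
Proof.
move=> mu0 pS; have [St Spos] := pS.
have uS : Sigma \in unitmx by rewrite unitmxE unitfE gt_eqF ?posdefmx22_det_gt0.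
have v0 : invmx Sigma *m mu != 0.
  by apply: contra_neq mu0 => v0; rewrite -(mulKVmx uS mu) v0 mulmx0.
have := Spos _ v0; rewrite trmx_mul trmx_inv St /mahalanobis.
by rewrite -!mulmxA mulKVmx.
Qed.

Lemma mvnormal_pdf_complete_square (R : realType) (mu : 'cV[R]_2) (Sigma : 'M[R]_2)
    (a : R) (y : 'cV[R]_2) : mu != 0 -> posdefmx Sigma ->
  let m := mahalanobis mu Sigma in
  let s := (m^-1 *: (mu^T *m invmx Sigma *m y)) 0 0 in
  mvnormal_pdf (a *: mu) Sigma y =
  mvnormal_pdf (s *: mu) Sigma y * expR (- (m / 2 * (a - s) ^+ 2)).
Proof.
move=> mu0 pS m s; have m0 := mahalanobis_gt0 mu0 pS.
rewrite /mvnormal_pdf -[RHS]mulrA -expRD; congr (_ * expR _).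
have [St _] := pS; set P := invmx Sigma.
have Pt : P^T = P by rewrite trmx_inv St.
(* Expanded as a polynomial in [b], to be compared at [b = a] and at its minimiser [b = s]. *)
have quad (b : R) : ((y - b *: mu)^T *m P *m (y - b *: mu)) 0 0 =
    (y^T *m P *m y) 0 0 - 2 * b * (mu^T *m P *m y) 0 0 + b ^+ 2 * m.
  (* Both sides are 1 x 1 matrices, hence equal to their own transposes. *)
  have sym : y^T *m P *m mu = mu^T *m P *m y.
    by rewrite [LHS]mx11_scalar -tr_scalar_mx -mx11_scalar
      !trmx_mul trmxK Pt mulmxA.
  have -> : (y - b *: mu)^T = y^T - b *: mu^T.
    by apply/matrixP => i j; rewrite !mxE.
  rewrite mulmxBl mulmxBl mulmxBr mulmxBr.
  rewrite -!scalemxAl -!scalemxAr sym /m /mahalanobis -/P !mxE; ring.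
have sE : s = m^-1 * (mu^T *m P *m y) 0 0 by rewrite [LHS]mxE.
rewrite !quad sE; field.
by rewrite gt_eqF.
Qed.

Lemma glass_likelihood (R : realType) (d : nat) (mu : 'cV[R]_2)
    (Sigma : 'M[R]_2) (x : 'M[R]_(2, d)) : mu != 0 -> posdefmx Sigma ->
  exists2 c : R, c != 0 &
    forall z : 'rV[R]_d,
      \prod_(j < d) mvnormal_pdf (z 0 j *: mu) Sigma (col j x) =
      c * gauss_kernel (mahalanobis mu Sigma) (suff_stat mu Sigma x) z.
Proof.
move=> mu0 pS; set m := mahalanobis _ _; set s := suff_stat _ _ _.
(* The constant is the likelihood at its maximiser [z = s]. *)
exists (\prod_(j < d) mvnormal_pdf (s 0 j *: mu) Sigma (col j x)).
  apply/prodf_neq0 => j _; rewrite mulf_neq0 ?gt_eqF ?expR_gt0// invr_gt0.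
  by rewrite sqrtr_gt0 mulr_gt0 ?posdefmx22_det_gt0// exprn_gt0// mulr_gt0 ?pi_gt0.
move=> z; rewrite /gauss_kernel mulr_sumr -sumrN expR_sum -big_split /=.
apply: eq_bigr => j _; rewrite mvnormal_pdf_complete_square//.
suff -> : s 0 j = (m^-1 *: (mu^T *m invmx Sigma *m col j x)) 0 0 by [].
by rewrite /s /suff_stat -/m !mxE; congr (_ * _); apply: eq_bigr => k _; rewrite !mxE.
Qed.

(** Since [a *: s - a *: z = a *: (s - z)], the variance [b ^+ 2] becomes [b ^+ 2 / a ^+ 2] around
    [s]; it is kept as an inverted quotient to match [inv_snr]. *)
Lemma denoiser_likelihood (R : realType) (d : nat) (a b : R) (s : 'rV[R]_d) :
  a != 0 -> b != 0 ->
  exists2 c : R, c != 0 &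
    forall z : 'rV[R]_d,
      mvnormal_pdf (a *: z)^T (b ^+ 2)%:M (a *: s)^T =
      c * gauss_kernel (b ^+ 2 / a ^+ 2)^-1 s z.
Proof.
move=> a0 b0.
exists (Num.sqrt ((2 * pi) ^+ d * \det ((b ^+ 2)%:M : 'M[R]_d)))^-1.
  rewrite gt_eqF// invr_gt0 sqrtr_gt0 det_scalar.
  have b2 : 0 < b ^+ 2 by rewrite exprn_even_gt0.
  by apply: mulr_gt0; apply: exprn_gt0; rewrite // mulr_gt0 ?pi_gt0.
move=> z; rewrite /mvnormal_pdf /gauss_kernel; congr (_ * expR _).
rewrite invmx_scalar -mulmxA mul_scalar_mx -scalemxAr !mxE !mulr_sumr -!sumrN.
rewrite mulr_suml; apply: eq_bigr => j _; rewrite !mxE; field.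
by rewrite a0 b0.
Qed.

Lemma C1_unit_interval_continuous (R : realType) (f : R -> R) :
  C1_unit_interval f -> {within `[0, 1], continuous f}.
Proof.
move=> [f' _ f'P]; apply/subspace_continuousP => t t01.
have ft : f s @[s --> within `[0, 1] t^'] --> f t.
  (* Near [t], [f s] is the difference quotient times [s - t], plus [f t]. *)
  have -> : f t = f' t * (t - t) + f t by ring.
  have : (f s - f t) / (s - t) * (s - t) + f t @[s --> within `[0, 1] t^']
      --> f' t * (t - t) + f t.
    apply: cvgD; last exact: cvg_cst.
    apply: cvgM; first exact: f'P.
    apply: cvgB; last exact: cvg_cst.
    exact: cvg_trans (cvg_within _) (cvg_within _).
  apply: cvg_trans; apply: near_eq_cvg.
  apply: (@filterS _ (nbhs t)) filterT => s _ st _.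
  by rewrite divfK ?subrK// subr_eq0.
(* From the punctured limit to continuity: the point [s = t] is treated apart. *)
move=> U Uft.
apply: (@filterS _ (nbhs t)) (ft _ Uft) => s Us s01.
have [->|st] := eqVneq s t; first exact: (nbhs_singleton Uft).
exact: Us.
Qed.

Lemma tstarP (R : realType) (alpha sigma : R -> R) (mu : 'cV[R]_2)
    (Sigma : 'M[R]_2) : scheduler alpha sigma ->
  0 < mahalanobis mu Sigma ->
  let t := tstar alpha sigma mu Sigma in
  [/\ alpha t != 0, sigma t != 0 &
      inv_snr alpha sigma t = (mahalanobis mu Sigma)^-1].
Proof.
move=> [age0 sge0 aC sC a0 s1 a1 s0 aincr sdecr] m0 t.
set m := mahalanobis mu Sigma in m0 t *.
(* Clearing denominators in [inv_snr u = m^-1] removes the pole at 0; the new function is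
   continuous, with values [m] at 0 and [-1] at 1. *)
have [u u01 um] : exists2 u, u \in `[0, 1] & sigma u ^+ 2 * m - alpha u ^+ 2 = 0.
  apply: (@IVT R (fun u => sigma u ^+ 2 * m - alpha u ^+ 2)) => //.
    have ca := C1_unit_interval_continuous aC.
    have cs := C1_unit_interval_continuous sC.
    move=> u; apply: cvgB; last by apply: cvgM; exact: ca.
    by apply: cvgM; [apply: cvgM; exact: cs|exact: cvg_cst].
  rewrite a0 s0 s1 a1; rewrite expr0n expr1n /= mul1r mul0r subr0 sub0r.
  by rewrite ge_min le_max lerN10 orbT ltW.
have alpha_gt0 v : v \in `]0, 1] -> 0 < alpha v.
  rewrite in_itv/= => /andP[v0 v1]; rewrite -a0; apply: aincr => //.
    by rewrite in_itv/= lexx ler01.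
  by rewrite in_itv/= ltW.
have u0 : u != 0.
  apply/eqP => u0; move: um; rewrite u0 a0 s0 expr1n expr0n /= mul1r subr0.
  by move=> m00; rewrite m00 ltxx in m0.
have u01' : u \in `]0, 1].
  by move: u01; rewrite !in_itv/= lt_neqAle eq_sym u0.
(* As [m^-1] is attained on []0, 1]], the partial inverse returns a genuine preimage there, not its
   default value. *)
have surj : set_surj `]0, 1] [set m^-1] (inv_snr alpha sigma).
  move=> _ ->; exists u => //; have au := alpha_gt0 _ u01'.
  have -> : inv_snr alpha sigma u = (sigma u ^+ 2 * m) / (alpha u ^+ 2 * m).
    by rewrite /inv_snr; field; rewrite !gt_eqF.
  rewrite (subr0_eq um); field; by rewrite !gt_eqF.
have tE : inv_snr alpha sigma t = m^-1 by apply: (surjpK _ surj); rewrite inE.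
have t01 : t \in `]0, 1].
  have := surjpinv_image_sub (dflt := fun=> 0) surj; apply.
  by exists m^-1.
split=> //; first by rewrite gt_eqF ?alpha_gt0.
(* If [sigma t] vanished, [m^-1] would be 0. *)
apply/eqP => st0; move: tE; rewrite /inv_snr st0 expr0n mul0r => /esym/eqP.
by rewrite invr_eq0 gt_eqF.
Qed.

Theorem proposition2 (R : realType) (d : nat)
    (p_data : probability (borel_rV R d) R)
    (alpha sigma : R -> R) (sched : scheduler alpha sigma)
    (mu : 'cV[R]_2) (mu_neq0 : mu != 0)
    (Sigma : 'M[R]_2) (Sigma_posdef : posdefmx Sigma)
    (x : 'M[R]_(2, d)) :
  let t := tstar alpha sigma mu Sigma in
  glass_denoiser p_data mu Sigma x =
  denoiser p_data alpha sigma t (alpha t *: suff_stat mu Sigma x).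
Proof.
move=> t.
have m0 := mahalanobis_gt0 mu_neq0 Sigma_posdef.
have [at0 st0 snrt] := tstarP sched m0.
rewrite /glass_denoiser /denoiser.
have [c c0 cE] := glass_likelihood x mu_neq0 Sigma_posdef.
have [k k0 kE] := denoiser_likelihood (suff_stat mu Sigma x) at0 st0.
(* By the choice of [t], both kernels now have precision [mahalanobis mu Sigma] and the same
   centre. *)
rewrite (funext cE) (funext kE) -/(inv_snr alpha sigma _) snrt invrK.
by rewrite !posterior_meanZ//; apply: integrable_gauss_kernel; exact: ltW.
Qed.
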